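(* Let $A\in M_k\otimes M_m$ be a weak irreducible PPT matrix. Let $A=\sum_{i=1}^n\lambda_i\gamma_i\otimes\delta_i$ be a Hermitian Schmidt decomposition of $A$ with $\lambda_1\geq\dots\geq\lambda_n>0$, where $n\geq 2$. Let $\mu$ be the least positive eigenvalue of $\gamma_1\otimes\delta_1$. If $$\frac{\lambda_1\mu}{\lambda_2+\dots+\lambda_n}\geq 1,$$ then $A$ is separable.
   Context: $M_k$ denotes the complex $k\times k$ matrices, and $M_k\otimes M_m$ is identified with $M_{km}$ via the Kronecker product. $M_k$ carries the inner product $\langle C,D\rangle=\mathrm{tr}(CD^* )$. A Hermitian projection is an orthogonal projection matrix. A Hermitian Schmidt decomposition of a Hermitian $A\in M_k\otimes M_m$ is an expression $A=\sum_{i=1}^n\lambda_i\gamma_i\otimes\delta_i$ with real $\lambda_i>0$, where $\{\gamma_1,\dots,\gamma_n\}\subset M_k$ and $\{\delta_1,\dots,\delta_n\}\subset M_m$ are orthonormal sets of Hermitian matrices. A positive semidefinite Hermitian matrix $A=\sum_i A_i\otimes B_i\in M_k\otimes M_m$ is PPT (positive under partial transposition) if $A^{t_1}=\sum_i A_i^t\otimes B_i$ is also positive semidefinite Hermitian. A positive semidefinite Hermitian matrix $A\in M_k\otimes M_m$ is weak irreducible if, for all Hermitian projections $V_1,V_2\in M_k$ and $W_1,W_2\in M_m$ with $V_1V_2=0$, $W_1W_2=0$, $V_1+V_2=Id\in M_k$ and $W_1+W_2=Id\in M_m$, the equality $A=\sum_{i=1}^2(V_i\otimes W_i)A(V_i\otimes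 W_i)$ implies that $(V_1\otimes W_1)A(V_1\otimes W_1)=0$ or $(V_2\otimes W_2)A(V_2\otimes W_2)=0$. $A\in M_k\otimes M_m$ is separable if $A=\sum_{i} C_i\otimes D_i$ (finite sum) with $C_i\in M_k$ and $D_i\in M_m$ positive semidefinite Hermitian for every $i$. *)

(* Defs.v *)
From HB Require Import structures.
From mathcomp Require Import all_boot all_order all_algebra.
From mathcomp Require Import reals.
From mathcomp Require Import complex mxtens.

Set Implicit Arguments.
Unset Strict Implicit.
Unset Printing Implicit Defensive.

Import Order.TTheory GRing.Theory Num.Theory.

Local Open Scope ring_scope.
Local Open Scope complex_scope.

Section ComplexMatrices.
Variable R : realType.
Local Notation C := R[i].

(* conjugate transpose A^* *)
Definition adjmx (p q : nat) (A : 'M[C]_(p, q)) : 'M[C]_(q, p) :=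
  map_mx Num.conj A^T.

Definition psdmx (p : nat) (A : 'M[C]_p) : Prop :=
  A \is hermsymmx /\ forall v : 'cV[C]_p, 0 <= (adjmx v *m A *m v) 0 0.

Definition hermitian_projection (p : nat) (V : 'M[C]_p) : Prop :=
  V \is hermsymmx /\ V *m V = V.

Definition hs_dot (p : nat) (A B : 'M[C]_p) : C := \tr (A *m adjmx B).

Definition hs_orthonormal (p n : nat) (g : 'I_n -> 'M[C]_p) : Prop :=
  forall i j : 'I_n, hs_dot (g i) (g j) = (i == j)%:R.

(* M_k (x) M_m is 'M_(k * m), with pure tensors given by the Kronecker product
   [*t] of [mxtens]. *)
Definition hermitian_schmidt (k m n : nat) (A : 'M[C]_(k * m))
    (lam : 'I_n -> R) (gam : 'I_n -> 'M[C]_k) (del : 'I_n -> 'M[C]_m) : Prop :=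
  [/\ forall i, 0 < lam i,
      forall i, gam i \is hermsymmx /\ del i \is hermsymmx,
      hs_orthonormal gam,
      hs_orthonormal del &
      A = \sum_(i < n) (lam i)%:C *: (gam i *t del i)].

(* The linear extension of A (x) B |-> A^T (x) B, see [partial_trmx_sum]. *)
Definition partial_trmx (k m : nat) (A : 'M[C]_(k * m)) : 'M[C]_(k * m) :=
  \matrix_(p, q)
    A (mxtens_index ((mxtens_unindex q).1, (mxtens_unindex p).2))
      (mxtens_index ((mxtens_unindex p).1, (mxtens_unindex q).2)).

Lemma partial_trmx_sum (k m n : nat) (A : 'I_n -> 'M[C]_k)
    (B : 'I_n -> 'M[C]_m) :
  partial_trmx (\sum_(i < n) A i *t B i) = \sum_(i < n) (A i)^T *t B i.
Proof.
apply/matrixP=> p q; rewrite !mxE !summxE; apply: eq_bigr => i _.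
by rewrite tensmxE !mxE.
Qed.

Definition ppt (k m : nat) (A : 'M[C]_(k * m)) : Prop :=
  psdmx A /\ psdmx (partial_trmx A).

Definition weak_irreducible (k m : nat) (A : 'M[C]_(k * m)) : Prop :=
  psdmx A /\
  forall (V1 V2 : 'M[C]_k) (W1 W2 : 'M[C]_m),
    hermitian_projection V1 -> hermitian_projection V2 ->
    hermitian_projection W1 -> hermitian_projection W2 ->
    V1 *m V2 = 0 -> W1 *m W2 = 0 ->
    V1 + V2 = 1%:M -> W1 + W2 = 1%:M ->
    A = (V1 *t W1) *m A *m (V1 *t W1) + (V2 *t W2) *m A *m (V2 *t W2) ->
    (V1 *t W1) *m A *m (V1 *t W1) = 0 \/ (V2 *t W2) *m A *m (V2 *t W2) = 0.

Definition separable (k m : nat) (A : 'M[C]_(k * m)) : Prop :=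
  exists (r : nat) (P : 'I_r -> 'M[C]_k) (Q : 'I_r -> 'M[C]_m),
    (forall i, psdmx (P i) /\ psdmx (Q i)) /\
    A = \sum_(i < r) P i *t Q i.

Definition least_positive_eigenvalue (p : nat) (A : 'M[C]_p) (mu : R) : Prop :=
  [/\ 0 < mu, eigenvalue A mu%:C &
      forall nu : R, 0 < nu -> eigenvalue A nu%:C -> mu <= nu].

End ComplexMatrices.

(* Main.v *)
(* Split gamma_1 = X+ - X- and delta_1 = Y+ - Y- into positive and negative parts.
   Since (X, Y) |-> tr (A (X (x) Y)) is nonnegative on positive matrices,
   (|gamma_1|, |delta_1|) is again a maximal singular pair, hence so is, up to
   scaling, each of (X+, Y+) and (X-, Y-).  With V and W the supports of such a
   pair, the blocks V (x) W' and V' (x) W annihilate A, and positivity of the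
   partial transpose kills the off-diagonal block, so A is block diagonal and weak
   irreducibility leaves a single block.  All gamma_i, delta_i are then supported
   in V, W, so gamma_1 (x) delta_1 = X (x) Y with X >= a V, Y >= b W and mu <= a b.
   What remains of A after extracting (lambda_2 + ... + lambda_n) V (x) W from the
   leading term is a combination of the matrices
   V (x) W + gamma_i (x) delta_i
     = ((V + gamma_i) (x) (W + delta_i) + (V - gamma_i) (x) (W - delta_i)) / 2. *)
Require Import Defs.
From HB Require Import structures.
From mathcomp Require Import all_boot all_order all_algebra.
From mathcomp Require Import reals.
From mathcomp Require Import complex mxtens.
From mathcomp Require Import ring.

Set Implicit Arguments.
Unset Strict Implicit.
Unset Printing Implicit Defensive.

Import Order.TTheory GRing.Theory Num.Theory.

Local Open Scope ring_scope.

(** * Positive semidefinite matrices *)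
Section Adjoint.
Variable R : realType.
Local Notation C := (R[i]%C).

Lemma adjmxK p q (A : 'M[C]_(p, q)) : adjmx (adjmx A) = A.
Proof. by apply/matrixP => i j; rewrite !mxE conjCK. Qed.

Lemma adjmxM p q r (A : 'M[C]_(p, q)) (B : 'M[C]_(q, r)) :
  adjmx (A *m B) = adjmx B *m adjmx A.
Proof. by rewrite /adjmx trmx_mul map_mxM. Qed.

Lemma adjmxD p q (A B : 'M[C]_(p, q)) : adjmx (A + B) = adjmx A + adjmx B.
Proof. by apply/matrixP => i j; rewrite !mxE rmorphD. Qed.

Lemma adjmxN p q (A : 'M[C]_(p, q)) : adjmx (- A) = - adjmx A.
Proof. by apply/matrixP => i j; rewrite !mxE rmorphN. Qed.

Lemma adjmxB p q (A B : 'M[C]_(p, q)) : adjmx (A - B) = adjmx A - adjmx B.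
Proof. by rewrite adjmxD adjmxN. Qed.

Lemma adjmxZ p q a (A : 'M[C]_(p, q)) : adjmx (a *: A) = Num.conj a *: adjmx A.
Proof. by apply/matrixP => i j; rewrite !mxE rmorphM. Qed.

Lemma adjmx1 p : adjmx (1%:M : 'M[C]_p) = 1%:M.
Proof. by rewrite /adjmx trmx1 map_mx1. Qed.

Lemma adjmx_tens p q r s (A : 'M[C]_(p, q)) (B : 'M[C]_(r, s)) :
  adjmx (A *t B) = adjmx A *t adjmx B.
Proof. by rewrite /adjmx trmx_tens map_mxT. Qed.

Lemma hermP p (A : 'M[C]_p) : A \is hermsymmx <-> adjmx A = A.
Proof.
split; first by move/is_hermitianmxP => {2}->; rewrite expr0 scale1r.
by move=> e; apply/is_hermitianmxP; rewrite expr0 scale1r.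
Qed.

Lemma mxtrace_gram p q (K : 'M[C]_(p, q)) :
  \tr (adjmx K *m K) = \sum_j \sum_i `|K i j| ^+ 2.
Proof.
apply: eq_bigr => j _; rewrite mxE; apply: eq_bigr => i _.
by rewrite !mxE normCK mulrC.
Qed.

Lemma mxtrace_gram_ge0 p q (K : 'M[C]_(p, q)) : 0 <= \tr (adjmx K *m K).
Proof. by rewrite mxtrace_gram; do 2![apply: sumr_ge0 => ? _]; apply: exprn_ge0. Qed.

Lemma mxtrace_gram_eq0 p q (K : 'M[C]_(p, q)) : \tr (adjmx K *m K) = 0 -> K = 0.
Proof.
rewrite mxtrace_gram => /eqP; rewrite psumr_eq0; last first.
  by move=> j _; apply: sumr_ge0 => i _; apply: exprn_ge0.
move=> /allP h; apply/matrixP => i j; rewrite mxE.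
have := h j (mem_index_enum _); rewrite psumr_eq0; last first.
  by move=> l _; apply: exprn_ge0.
by move=> /allP /(_ i (mem_index_enum _)); rewrite expf_eq0 /= normr_eq0 => /eqP.
Qed.

Lemma mulmx11_gram p (K : 'cV[C]_p) : (adjmx K *m K) 0 0 = \tr (adjmx K *m K).
Proof. by rewrite /mxtrace big_ord1. Qed.

Lemma psd_gram p q (N : 'M[C]_(q, p)) : psdmx (adjmx N *m N).
Proof.
split; first by apply/hermP; rewrite adjmxM adjmxK.
by move=> v; rewrite mulmxA -adjmxM -mulmxA mulmx11_gram mxtrace_gram_ge0.
Qed.

Lemma psd_herm p (A : 'M[C]_p) : psdmx A -> adjmx A = A.
Proof. by case=> /hermP. Qed.

Lemma psdZ p a (A : 'M[C]_p) : 0 <= a -> psdmx A -> psdmx (a *: A).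
Proof.
move=> a0 [hA pA]; split.
  by apply/hermP; rewrite adjmxZ geC0_conj //; move/hermP: hA => ->.
by move=> v; rewrite -scalemxAr -scalemxAl mxE mulr_ge0.
Qed.

Lemma psd_congr p q (A : 'M[C]_p) (B : 'M[C]_(p, q)) :
  psdmx A -> psdmx (adjmx B *m A *m B).
Proof.
case=> /hermP hA pA; split.
  by apply/hermP; rewrite !adjmxM adjmxK hA mulmxA.
by move=> v; have := pA (B *m v); rewrite adjmxM !mulmxA.
Qed.

(** The form of [A^T] at [v] is the [1 x 1] transpose of the form of [A] at the entrywise conjugate
    of [v]. *)
Lemma psd_tr p (A : 'M[C]_p) : psdmx A -> psdmx A^T.
Proof.
case=> /hermP hA pA; split.
  by apply/hermP; rewrite -[in RHS]hA; apply/matrixP => i j; rewrite !mxE.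
move=> v; suff -> : adjmx v *m A^T *m v =
    (adjmx (adjmx v^T) *m A *m adjmx v^T)^T by rewrite mxE.
by rewrite adjmxK !trmx_mul trmxK mulmxA /adjmx map_trmx trmxK.
Qed.

Lemma psd_proj p (V : 'M[C]_p) : hermitian_projection V -> psdmx V.
Proof. by case=> /hermP hV VV; rewrite -VV -{1}hV; apply: psd_gram. Qed.

Lemma hermitian_projection_compl p (V : 'M[C]_p) :
  hermitian_projection V -> hermitian_projection (1%:M - V).
Proof.
case=> /hermP hV VV; split; first by apply/hermP; rewrite adjmxB adjmx1 hV.
by rewrite mulmxBl mul1mx mulmxBr mulmx1 VV subrr subr0.
Qed.

Lemma hs_dot_ge0 p (A : 'M[C]_p) : 0 <= hs_dot A A.
Proof. by have := mxtrace_gram_ge0 (adjmx A); rewrite adjmxK. Qed.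

Lemma hs_dot_eq0 p (A : 'M[C]_p) : hs_dot A A = 0 -> A = 0.
Proof.
move=> h; have /mxtrace_gram_eq0 e : \tr (adjmx (adjmx A) *m adjmx A) = 0.
  by rewrite adjmxK.
by rewrite -[A]adjmxK e; apply/matrixP => i j; rewrite !mxE rmorph0.
Qed.

End Adjoint.

(** * Spectral calculus *)
Section Spectral.
Variable R : realType.
Local Notation C := (R[i]%C).

(** The rows of [U] serve as left eigenvectors, matching the row-vector convention of [eigenvalue].
    Values are attached to the index [j], so matrices built on one [U] are added and multiplied
    pointwise. *)
Definition spectral_fun p (U : 'M[C]_p) (e : 'I_p -> C) : 'M[C]_p :=
  adjmx U *m diag_mx (\row_j e j) *m U.

Lemma herm_spectral p (H : 'M[C]_p) : H \is hermsymmx ->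
  exists U : 'M[C]_p, exists e : 'I_p -> C,
    [/\ U *m adjmx U = 1%:M, forall j, e j \is Num.real & H = spectral_fun U e].
Proof.
move=> hH; exists (spectralmx H), (spectral_diag H 0); split.
- exact/unitarymxP/spectral_unitarymx.
- by move=> j; move/mxOverP: (hermitian_spectral_diag_real hH) => /(_ 0 j).
have /orthomx_spectralP := hermitian_normalmx hH.
rewrite (invmx_unitary (spectral_unitarymx H)) => {1}->.
congr (_ *m _ *m _); congr diag_mx.
by apply/rowP => j; rewrite mxE.
Qed.

Variables (p : nat) (U : 'M[C]_p).
Hypothesis UU : U *m adjmx U = 1%:M.

Lemma spectral_funM e f :
  spectral_fun U e *m spectral_fun U f = spectral_fun U (fun j => e j * f j).
Proof.
rewrite /spectral_fun !mulmxA -[_ *m U *m adjmx U]mulmxA UU mulmx1.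
congr (_ *m _); rewrite -mulmxA mulmx_diag; congr (_ *m diag_mx _).
by apply/rowP => j; rewrite !mxE.
Qed.

Lemma spectral_funB e f :
  spectral_fun U e - spectral_fun U f = spectral_fun U (fun j => e j - f j).
Proof.
rewrite /spectral_fun -mulmxBl -mulmxBr -raddfB /=; congr (_ *m diag_mx _ *m _).
by apply/rowP => j; rewrite !mxE.
Qed.

Lemma spectral_funZ a e :
  a *: spectral_fun U e = spectral_fun U (fun j => a * e j).
Proof.
rewrite /spectral_fun scalemxAl scalemxAr -linearZ /=.
congr (_ *m diag_mx _ *m _).
by apply/rowP => j; rewrite !mxE.
Qed.

Lemma eq_spectral_fun e f : e =1 f -> spectral_fun U e = spectral_fun U f.
Proof.
move=> ef; congr (_ *m diag_mx _ *m _).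
by apply/rowP => j; rewrite !mxE.
Qed.

Lemma spectral_fun0 : spectral_fun U (fun=> 0) = 0.
Proof.
rewrite /spectral_fun [diag_mx _](_ : _ = 0) ?mulmx0 ?mul0mx //.
by apply/matrixP => i j; rewrite !mxE mul0rn.
Qed.

Lemma spectral_fun_adj e :
  adjmx (spectral_fun U e) = spectral_fun U (fun j => Num.conj (e j)).
Proof.
rewrite /spectral_fun !adjmxM adjmxK mulmxA; congr (_ *m _ *m _).
apply/matrixP => i j; rewrite !mxE eq_sym; case: eqP => [->|_].
  by rewrite !mulr1n.
by rewrite !mulr0n rmorph0.
Qed.

Lemma spectral_fun_psd e : (forall j, 0 <= e j) -> psdmx (spectral_fun U e).
Proof.
move=> e0; have -> : spectral_fun U e = adjmx (spectral_fun U (fun j => sqrtC (e j))) *m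
   spectral_fun U (fun j => sqrtC (e j)).
  rewrite spectral_fun_adj spectral_funM; apply: eq_spectral_fun => j.
  by rewrite geC0_conj ?sqrtC_ge0 // -expr2 sqrtCK.
exact: psd_gram.
Qed.

Lemma row_spectral_fun e j : row j U *m spectral_fun U e = e j *: row j U.
Proof.
rewrite /spectral_fun !mulmxA -row_mul UU -row_mul mul1mx row_diag_mx.
by rewrite -scalemxAl -rowE mxE.
Qed.

Lemma row_spectral_neq0 j : row j U != 0.
Proof.
apply/eqP => r0; have : row j (U *m adjmx U) = 0 by rewrite row_mul r0 mul0mx.
move/rowP => /(_ j); rewrite UU !mxE eqxx => /eqP.
by rewrite oner_eq0.
Qed.

(** The quadratic form at the adjoint of the unit vector [row j U] is exactly [e j]. *)
Lemma spectral_fun_psdE e : psdmx (spectral_fun U e) -> forall j, 0 <= e j.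
Proof.
case=> _ h j; have := h (adjmx (row j U)).
rewrite adjmxK row_spectral_fun -scalemxAl mxE.
suff -> : (row j U *m adjmx (row j U)) 0 0 = 1 by rewrite mulr1.
have /matrixP /(_ j j) := UU; rewrite !mxE eqxx mulr1n => <-.
by apply: eq_bigr => i _; rewrite !mxE.
Qed.

End Spectral.

(** * Gram factors, Jordan decomposition and supports of positive matrices *)

Section SpectralConsequences.
Variable R : realType.
Local Notation C := (R[i]%C).

Lemma psd_factor p (A : 'M[C]_p) : psdmx A -> exists N : 'M[C]_p, A = adjmx N *m N.
Proof.
move=> pA; have [hA _] := pA; have [U [e [UU _ Ae]]] := herm_spectral hA.
have e0 : forall j, 0 <= e j by apply: (spectral_fun_psdE UU); rewrite -Ae.
exists (spectral_fun U (fun j => sqrtC (e j))).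
rewrite spectral_fun_adj (spectral_funM UU) Ae; apply: eq_spectral_fun => j.
by rewrite geC0_conj ?sqrtC_ge0 // -expr2 sqrtCK.
Qed.

Lemma psd_tens p q (X : 'M[C]_p) (Y : 'M[C]_q) :
  psdmx X -> psdmx Y -> psdmx (X *t Y).
Proof.
move=> /psd_factor [M ->] /psd_factor [N ->].
by rewrite -tensmx_mul -adjmx_tens; apply: psd_gram.
Qed.

(** With Gram factors [N] of [A] and [M] of [X], the trace is the squared norm of [N *m adjmx M]. *)
Lemma psd_mxtrace_ge0 p (A X : 'M[C]_p) : psdmx A -> psdmx X -> 0 <= \tr (A *m X).
Proof.
move=> /psd_factor [N ->] /psd_factor [M ->].
rewrite mulmxA mxtrace_mulC.
have := mxtrace_gram_ge0 (N *m adjmx M).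
by rewrite adjmxM adjmxK !mulmxA.
Qed.

(** A vanishing trace forces [N *m adjmx M = 0] for the Gram factors, and this product is an inner
    factor of [A *m X]. *)
Lemma psd_mxtrace_eq0 p (A X : 'M[C]_p) :
  psdmx A -> psdmx X -> \tr (A *m X) = 0 -> A *m X = 0.
Proof.
move=> /psd_factor [N ->] /psd_factor [M ->].
rewrite mulmxA mxtrace_mulC => h.
have NM0 : N *m adjmx M = 0.
  by apply: mxtrace_gram_eq0; rewrite adjmxM adjmxK !mulmxA -[RHS]h !mulmxA.
by rewrite -[adjmx N *m N *m _]mulmxA NM0 mulmx0 mul0mx.
Qed.

(** The eigenvalues are sorted by sign; the two parts share [U] but have disjoint sets of nonzero
    eigenvalues. *)
Lemma jordan_decomposition p (H : 'M[C]_p) : H \is hermsymmx ->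
  exists Hp Hm : 'M[C]_p,
    [/\ psdmx Hp, psdmx Hm, H = Hp - Hm & Hp *m Hm = 0].
Proof.
move=> hH; have [U [e [UU re ->]]] := herm_spectral hH.
exists (spectral_fun U (fun j => if 0 <= e j then e j else 0)).
exists (spectral_fun U (fun j => if 0 <= e j then 0 else - e j)).
split.
- by apply: spectral_fun_psd => // j; case: ifP.
- apply: spectral_fun_psd => // j; case: ifP => // /negbT e0.
  by rewrite oppr_ge0; move: (re j); rewrite realE (negbTE e0).
- rewrite spectral_funB; apply: eq_spectral_fun => j.
  by case: ifP; rewrite ?subr0 ?sub0r ?opprK.
- rewrite (spectral_funM UU) -(spectral_fun0 U).
  by apply: eq_spectral_fun => j; case: ifP; rewrite ?mulr0 ?mul0r.
Qed.

(** [V] is the indicator of the nonzero eigenvalues, [Z] the pseudo-inverse of [X], and [a] the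
    least nonzero eigenvalue. Writing [V] through [Z] on either side lets every annihilation by [X]
    pass to [V]. *)
Lemma psd_support p (X : 'M[C]_p) : psdmx X -> X != 0 ->
  exists V Z : 'M[C]_p, exists a : C,
    [/\ hermitian_projection V, X *m V = X, V = X *m Z, V = Z *m X &
        [/\ 0 < a, eigenvalue X a & psdmx (X - a *: V)]].
Proof.
move=> pX X0; have [hX _] := pX; have [U [e [UU _ Xe]]] := herm_spectral hX.
have e0 : forall j, 0 <= e j by apply: (spectral_fun_psdE UU); rewrite -Xe.
have [j0 ej0] : exists j, e j != 0.
  apply/existsP; apply: contraNT X0; rewrite negb_exists => /forallP h.
  rewrite Xe -(spectral_fun0 U); apply/eqP/eq_spectral_fun => j.
  by have := h j; rewrite negbK => /eqP.
(* The order on complex numbers is partial, so the minimum is taken over real parts, which determine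
   the nonnegative [e j]. *)
case: (@Order.TotalTheory.arg_minP _ _ _ j0 (fun j => e j != 0)
  (fun j => complex.Re (e j)) ej0) => j1 ej1 min1.
exists (spectral_fun U (fun j => (e j != 0)%:R)).
exists (spectral_fun U (fun j => (e j)^-1)), (e j1).
split.
- split; first apply/hermP; rewrite ?spectral_fun_adj ?(spectral_funM UU);
    apply: eq_spectral_fun => j; rewrite ?rmorph_nat //.
  by case: (_ != 0); rewrite ?mulr1 ?mulr0.
- rewrite Xe (spectral_funM UU); apply: eq_spectral_fun => j.
  by case: eqP => [->|_]; rewrite ?mulr1 ?mulr0.
- rewrite Xe (spectral_funM UU); apply: eq_spectral_fun => j.
  by have [->|/divff ->//] := eqVneq (e j) 0; rewrite mul0r.
- rewrite Xe (spectral_funM UU); apply: eq_spectral_fun => j.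
  by have [->|/mulVf ->//] := eqVneq (e j) 0; rewrite mulr0.
split; first by rewrite lt_def ej1 e0.
  apply/eigenvalueP; exists (row j1 U); last exact: row_spectral_neq0.
  by rewrite Xe row_spectral_fun.
rewrite {1}Xe spectral_funZ spectral_funB; apply: spectral_fun_psd => // j.
have [->|ej] := eqVneq (e j) 0; first by rewrite mulr0 subrr.
rewrite mulr1 subr_ge0 lecE min1 // andbT.
by rewrite !ger0_Im.
Qed.

End SpectralConsequences.
(** * Kronecker products *)
Section TensorProduct.
Variable R : comPzRingType.

Lemma tensmxDl m n p q (A B : 'M[R]_(m, n)) (M : 'M[R]_(p, q)) :
  (A + B) *t M = A *t M + B *t M.
Proof. by apply/matrixP => i j; rewrite !mxE mulrDl. Qed.

Lemma tensmxDr m n p q (A : 'M[R]_(m, n)) (M N : 'M[R]_(p, q)) :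
  A *t (M + N) = A *t M + A *t N.
Proof. by apply/matrixP => i j; rewrite !mxE mulrDr. Qed.

Lemma tensmxNl m n p q (A : 'M[R]_(m, n)) (M : 'M[R]_(p, q)) :
  (- A) *t M = - (A *t M).
Proof. by apply/matrixP => i j; rewrite !mxE mulNr. Qed.

Lemma tensmxNr m n p q (A : 'M[R]_(m, n)) (M : 'M[R]_(p, q)) :
  A *t (- M) = - (A *t M).
Proof. by apply/matrixP => i j; rewrite !mxE mulrN. Qed.

Lemma tensmxZl m n p q a (A : 'M[R]_(m, n)) (M : 'M[R]_(p, q)) :
  (a *: A) *t M = a *: (A *t M).
Proof. by apply/matrixP => i j; rewrite !mxE mulrA. Qed.

Lemma tensmxZr m n p q a (A : 'M[R]_(m, n)) (M : 'M[R]_(p, q)) :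
  A *t (a *: M) = a *: (A *t M).
Proof. by apply/matrixP => i j; rewrite !mxE mulrCA. Qed.

Lemma tensmx11 m n : (1%:M : 'M[R]_m) *t (1%:M : 'M[R]_n) = 1%:M.
Proof.
apply/matrixP => i j.
case: (mxtens_indexP i) => i1 i2; case: (mxtens_indexP j) => j1 j2.
rewrite tensmxE !mxE -natrM mulnb (can_eq (@mxtens_indexK _ _)).
by rewrite xpair_eqE.
Qed.

Lemma mxtrace_tens m n (A : 'M[R]_m) (B : 'M[R]_n) :
  \tr (A *t B) = \tr A * \tr B.
Proof. by rewrite /mxtrace mulr_sum; apply: eq_bigr => i _; rewrite mxE. Qed.

End TensorProduct.

(** * Hilbert-Schmidt geometry *)
Section HilbertSchmidt.
Variable R : realType.
Local Notation C := (R[i]%C).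

Lemma hs_dotC p (A B : 'M[C]_p) : hs_dot B A = Num.conj (hs_dot A B).
Proof.
rewrite /hs_dot -[B in LHS]adjmxK -adjmxM /adjmx -trace_map_mx.
by rewrite -[in LHS]map_trmx mxtrace_tr.
Qed.

Lemma hs_dotBl p (A B D : 'M[C]_p) : hs_dot (A - B) D = hs_dot A D - hs_dot B D.
Proof. by rewrite /hs_dot mulmxBl raddfB. Qed.

Lemma hs_dotBr p (A B D : 'M[C]_p) : hs_dot D (A - B) = hs_dot D A - hs_dot D B.
Proof. by rewrite /hs_dot adjmxB mulmxBr raddfB. Qed.

Lemma hs_dotZl p a (A D : 'M[C]_p) : hs_dot (a *: A) D = a * hs_dot A D.
Proof. by rewrite /hs_dot -scalemxAl mxtraceZ. Qed.

Lemma hs_dotZr p a (A D : 'M[C]_p) : hs_dot D (a *: A) = Num.conj a * hs_dot D A.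
Proof. by rewrite /hs_dot adjmxZ -scalemxAr mxtraceZ. Qed.

Lemma hs_dot_suml p n (c : 'I_n -> C) (g : 'I_n -> 'M[C]_p) D :
  hs_dot (\sum_i c i *: g i) D = \sum_i c i * hs_dot (g i) D.
Proof.
rewrite /hs_dot mulmx_suml raddf_sum; apply: eq_bigr => i _.
by rewrite -scalemxAl /= mxtraceZ.
Qed.

Lemma hs_orthonormal_dot p n (c : 'I_n -> C) (g : 'I_n -> 'M[C]_p) j :
  hs_orthonormal g -> hs_dot (\sum_i c i *: g i) (g j) = c j.
Proof.
move=> og; rewrite hs_dot_suml (bigD1 j) //= og eqxx mulr1 big1 ?addr0 //.
by move=> i /negbTE ij; rewrite og ij mulr0.
Qed.

Lemma hs_orthonormal_norm p n (c : 'I_n -> C) (g : 'I_n -> 'M[C]_p) :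
  hs_orthonormal g ->
  hs_dot (\sum_i c i *: g i) (\sum_i c i *: g i) = \sum_i `|c i| ^+ 2.
Proof.
move=> og; rewrite hs_dot_suml; apply: eq_bigr => i _.
by rewrite hs_dotC hs_orthonormal_dot // normCK.
Qed.

(** The squared norm of [P - S], with [S] the projection of [P] onto the span of [g], is the
    difference of the two sides. *)
Lemma bessel p n (g : 'I_n -> 'M[C]_p) (P : 'M[C]_p) :
  hs_orthonormal g -> \sum_i `|hs_dot P (g i)| ^+ 2 <= hs_dot P P.
Proof.
move=> og; set S := \sum_i hs_dot P (g i) *: g i.
have SP : hs_dot S P = \sum_i `|hs_dot P (g i)| ^+ 2.
  by rewrite hs_dot_suml; apply: eq_bigr => i _; rewrite (hs_dotC P) normCK.
have PS : hs_dot P S = hs_dot S P.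
  rewrite hs_dotC geC0_conj // SP; apply: sumr_ge0 => i _; exact: exprn_ge0.
have := hs_dot_ge0 (P - S).
rewrite hs_dotBl !hs_dotBr PS hs_orthonormal_norm // SP subrr subr0.
by rewrite subr_ge0.
Qed.

(* The singular values are at most [L], so this is equality in Cauchy-Schwarz. *)
Lemma singular_pair_of_max p q n (lam : 'I_n -> R) (L : R)
    (gam : 'I_n -> 'M[C]_p) (del : 'I_n -> 'M[C]_q) (P : 'M[C]_p) (Q : 'M[C]_q) :
  hs_orthonormal gam -> hs_orthonormal del ->
  (forall i, 0 <= lam i <= L) -> 0 <= L ->
  hs_dot P P = 1 -> hs_dot Q Q = 1 ->
  real_complex _ L <=
    hs_dot (\sum_i (real_complex _ (lam i) * hs_dot P (gam i)) *: del i) Q ->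
  \sum_i (real_complex _ (lam i) * hs_dot P (gam i)) *: del i
    = real_complex _ L *: Q.
Proof.
move=> og od lamL; rewrite -ler0c => L0 P1 Q1; set G := \sum_i _ => LGQ.
have rGQ : hs_dot Q G = hs_dot G Q.
  by rewrite hs_dotC geC0_conj // (le_trans L0).
(* Bessel's inequality for [P], with each singular value bounded by [L]. *)
have GG : hs_dot G G <= real_complex _ L ^+ 2.
  rewrite hs_orthonormal_norm //.
  apply: (@le_trans _ _ (\sum_i real_complex _ L ^+ 2 * `|hs_dot P (gam i)| ^+ 2)).
    apply: ler_sum => i _; have /andP[l0 lL] := lamL i.
    have l0' : 0 <= real_complex _ (lam i) by rewrite ler0c.
    rewrite normrM exprMn ler_wpM2r ?exprn_ge0 // (ger0_norm l0').
    by rewrite lerXn2r ?nnegrE // lecR.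
  rewrite -mulr_sumr ler_piMr ?exprn_ge0 //.
  by rewrite -P1; apply: bessel.
apply/eqP; rewrite -subr_eq0; apply/eqP/hs_dot_eq0/le_anti; rewrite hs_dot_ge0 andbT.
rewrite hs_dotBl !hs_dotBr !hs_dotZl !hs_dotZr rGQ Q1 (geC0_conj L0) mulr1.
have h : real_complex _ L * real_complex _ L <= real_complex _ L * hs_dot G Q.
  exact: ler_wpM2l.
set l := real_complex _ L in GG h *; set x := hs_dot G Q in h *.
(* The squared norm of [G - L *: Q] is regrouped so that [GG] bounds the first bracket and [h] the
   second. *)
rewrite (_ : _ - _ = (hs_dot G G - l ^+ 2) - 2%:R * (l * x - l * l)); last by ring.
rewrite subr_le0; apply: (@le_trans _ _ 0); first by rewrite subr_le0.
by rewrite mulr_ge0 ?ler0n // subr_ge0.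
Qed.

(** The squares of the eigenvalues of [g] sum to 1, so each eigenvalue is at least -1 and [1%:M + g]
    is positive; compressing it by [V] yields [V + g]. *)
Lemma proj_shift_psd p (V g : 'M[C]_p) :
  hermitian_projection V -> g \is hermsymmx -> hs_dot g g = 1 -> g *m V = g ->
  psdmx (V + g).
Proof.
move=> [/hermP hV VV] hg g1 gV; have /hermP ag := hg.
have Vg : V *m g = g by rewrite -{1}ag -hV -adjmxM gV ag.
have -> : V + g = adjmx V *m (1%:M + g) *m V.
  by rewrite hV mulmxDr mulmxDl mulmx1 VV Vg gV.
apply: psd_congr.
have [U [e [UU re ge]]] := herm_spectral hg.
have tr2 : \sum_j e j * e j = 1.
  rewrite -g1 /hs_dot ag ge (spectral_funM UU) /spectral_fun.
  rewrite mxtrace_mulC mulmxA UU mul1mx.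
  by rewrite mxtrace_diag; apply: eq_bigr => j _; rewrite mxE.
have e1 j : - e j <= 1.
  suff : `|e j| <= 1 by rewrite -normrN; apply/le_trans/real_ler_norm; rewrite rpredN.
  rewrite -(@expr_le1 _ 2) // real_normK // expr2 -tr2 (bigD1 j) //= lerDl.
  by apply: sumr_ge0 => i _; rewrite -expr2 real_exprn_even_ge0.
have -> : 1%:M + g = spectral_fun U (fun j => 1 - - e j).
  rewrite ge -spectral_funB /spectral_fun; congr (_ + _).
    rewrite (_ : diag_mx _ = 1%:M) ?mulmx1 ?(mulmx1C UU) //.
    by apply/matrixP => i j; rewrite !mxE.
  rewrite (_ : diag_mx (\row_j - e j) = - diag_mx (\row_j e j)) ?mulmxN ?mulNmx ?opprK //.
  by apply/matrixP => i j; rewrite !mxE mulNrn.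
by apply: spectral_fun_psd => // j; rewrite subr_ge0.
Qed.

End HilbertSchmidt.

(** * Separable matrices *)
Section Separable.
Variable R : realType.
Local Notation C := (R[i]%C).

Lemma separable_tens k m (P : 'M[C]_k) (Q : 'M[C]_m) :
  psdmx P -> psdmx Q -> separable (P *t Q).
Proof.
by exists 1%N, (fun=> P), (fun=> Q); rewrite big_ord1.
Qed.

Lemma separable0 k m : separable (0 : 'M[C]_(k * m)).
Proof.
by exists 0%N, (fun=> 0), (fun=> 0); rewrite big_ord0; split=> // -[].
Qed.

Lemma separableD k m (A B : 'M[C]_(k * m)) :
  separable A -> separable B -> separable (A + B).
Proof.
move=> [r [P [Q [h ->]]]] [s [P' [Q' [h' ->]]]].
exists (r + s)%N, (fun i => match split i with inl j => P j | inr j => P' j end),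
  (fun i => match split i with inl j => Q j | inr j => Q' j end).
split; first by move=> i; case: (split i).
rewrite big_split_ord /=; congr (_ + _); apply: eq_bigr => i _.
  by rewrite (unsplitK (inl _ i)).
by rewrite (unsplitK (inr _ i)).
Qed.

Lemma separable_sum k m (I : finType) (S : pred I) (F : I -> 'M[C]_(k * m)) :
  (forall i, S i -> separable (F i)) -> separable (\sum_(i | S i) F i).
Proof. by move=> h; apply: big_ind => //; [exact: separable0 | exact: separableD]. Qed.

Lemma separableZ k m a (A : 'M[C]_(k * m)) :
  0 <= a -> separable A -> separable (a *: A).
Proof.
move=> a0 [r [P [Q [h ->]]]]; rewrite scaler_sumr.
apply: separable_sum => i _; rewrite -tensmxZl; have [hP hQ] := h i.
by apply: separable_tens => //; apply: psdZ.
Qed.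

Lemma separable_proj_shift k m (V g : 'M[C]_k) (W d : 'M[C]_m) :
  hermitian_projection V -> hermitian_projection W ->
  g \is hermsymmx -> d \is hermsymmx -> hs_dot g g = 1 -> hs_dot d d = 1 ->
  g *m V = g -> d *m W = d -> separable (V *t W + g *t d).
Proof.
move=> pV pW hg hd g1 d1 gV dW.
(* Changing the sign preserves the hypotheses, so [proj_shift_psd] also covers [V - g] and
   [W - d]. *)
have opp p (x : 'M[C]_p) : x \is hermsymmx -> hs_dot x x = 1 ->
    - x \is hermsymmx /\ hs_dot (- x) (- x) = 1.
  move=> /hermP hx x1; split; first by apply/hermP; rewrite adjmxN hx.
  by rewrite /hs_dot adjmxN mulNmx mulmxN opprK.
have [hg' g1'] := opp _ _ hg g1; have [hd' d1'] := opp _ _ hd d1.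
have -> : V *t W + g *t d =
    2^-1 *: ((V + g) *t (W + d) + (V + - g) *t (W + - d)).
  apply: (@scalerI _ _ 2%:R); first by rewrite pnatr_eq0.
  rewrite scalerA divff ?pnatr_eq0 // scale1r.
  rewrite !tensmxDl !tensmxDr !tensmxNl !tensmxNr.
  by apply/matrixP => i j; rewrite !mxE; ring.
apply: separableZ; first by rewrite invr_ge0 ler0n.
by apply: separableD; apply: separable_tens;
  apply: proj_shift_psd; rewrite ?mulNmx ?gV ?dW.
Qed.

End Separable.
(** * The operator of a Schmidt decomposition *)
Section SchmidtOperator.
Variable R : realType.
Local Notation C := (R[i]%C).

(** For a Schmidt decomposition of [A], this is the partial trace of [A *m (X *t 1%:M)] over the
    first factor. No adjoint is taken, which makes no difference against the Hermitian [gam i]. *)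
Definition schmidt_op p q n (lam : 'I_n -> R) (gam : 'I_n -> 'M[C]_p)
    (del : 'I_n -> 'M[C]_q) (X : 'M[C]_p) : 'M[C]_q :=
  \sum_i (real_complex _ (lam i) * \tr (X *m gam i)) *: del i.

Definition schmidt_form p q n (lam : 'I_n -> R) (gam : 'I_n -> 'M[C]_p)
    (del : 'I_n -> 'M[C]_q) (X : 'M[C]_p) (Y : 'M[C]_q) : C :=
  \sum_i real_complex _ (lam i) * \tr (X *m gam i) * \tr (Y *m del i).

(** Exchanging the tensor factors transposes the operator, so facts proved for one factor transfer
    to the other. *)
Lemma schmidt_formC p q n (lam : 'I_n -> R) (gam : 'I_n -> 'M[C]_p)
    (del : 'I_n -> 'M[C]_q) X Y :
  schmidt_form lam gam del X Y = schmidt_form lam del gam Y X.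
Proof. by apply: eq_bigr => i _; rewrite mulrAC. Qed.

Lemma schmidt_formE p q n (lam : 'I_n -> R) (gam : 'I_n -> 'M[C]_p)
    (del : 'I_n -> 'M[C]_q) X Y :
  schmidt_form lam gam del X Y = \tr (schmidt_op lam gam del X *m Y).
Proof.
rewrite /schmidt_op mulmx_suml raddf_sum; apply: eq_bigr => i _.
by rewrite -scalemxAl /= mxtraceZ (mxtrace_mulC Y).
Qed.

Lemma schmidt_opD p q n (lam : 'I_n -> R) (gam : 'I_n -> 'M[C]_p)
    (del : 'I_n -> 'M[C]_q) X X' :
  schmidt_op lam gam del (X + X') =
  schmidt_op lam gam del X + schmidt_op lam gam del X'.
Proof.
rewrite /schmidt_op -big_split; apply: eq_bigr => i _.
by rewrite /= mulmxDl raddfD mulrDr scalerDl.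
Qed.

Lemma schmidt_opZ p q n (lam : 'I_n -> R) (gam : 'I_n -> 'M[C]_p)
    (del : 'I_n -> 'M[C]_q) a X :
  schmidt_op lam gam del (a *: X) = a *: schmidt_op lam gam del X.
Proof.
rewrite /schmidt_op scaler_sumr; apply: eq_bigr => i _.
by rewrite -scalemxAl mxtraceZ scalerA; congr (_ *: _); ring.
Qed.

Lemma schmidt_op_basis p q n (lam : 'I_n -> R) (gam : 'I_n -> 'M[C]_p)
    (del : 'I_n -> 'M[C]_q) j :
  (forall i, gam i \is hermsymmx) -> hs_orthonormal gam ->
  schmidt_op lam gam del (gam j) = real_complex _ (lam j) *: del j.
Proof.
move=> hg og; have trg i : \tr (gam j *m gam i) = (j == i)%:R.
  by rewrite -(og j i) /hs_dot; have /hermP -> := hg i.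
rewrite /schmidt_op (bigD1 j) //= trg eqxx mulr1 big1 ?addr0 //.
by move=> i ij; rewrite trg eq_sym (negbTE ij) mulr0 scale0r.
Qed.

Lemma mxtrace_schmidt k m n (A : 'M[C]_(k * m)) (lam : 'I_n -> R)
    (gam : 'I_n -> 'M[C]_k) (del : 'I_n -> 'M[C]_m) X Y :
  A = \sum_i real_complex _ (lam i) *: (gam i *t del i) ->
  \tr (A *m (X *t Y)) = schmidt_form lam gam del X Y.
Proof.
move=> ->; rewrite mulmx_suml raddf_sum; apply: eq_bigr => i _.
rewrite -scalemxAl /= mxtraceZ tensmx_mul mxtrace_tens.
by rewrite (mxtrace_mulC X) (mxtrace_mulC Y) mulrA.
Qed.

(* By positivity [|gam j|] and [|del j|] attain the maximum [lam j] of the form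
   as well, so they are a singular pair; add and subtract [gam j], [del j]. *)
Lemma top_positive_part p q n (lam : 'I_n -> R) (gam : 'I_n -> 'M[C]_p)
    (del : 'I_n -> 'M[C]_q) j (Xp Xm : 'M[C]_p) (Yp Ym : 'M[C]_q) :
  hs_orthonormal gam -> hs_orthonormal del ->
  (forall i, gam i \is hermsymmx) -> (forall i, del i \is hermsymmx) ->
  (forall i, 0 <= lam i <= lam j) ->
  (forall X Y, psdmx X -> psdmx Y -> 0 <= schmidt_form lam gam del X Y) ->
  psdmx Xp -> psdmx Xm -> gam j = Xp - Xm -> Xp *m Xm = 0 ->
  psdmx Yp -> psdmx Ym -> del j = Yp - Ym -> Yp *m Ym = 0 ->
  schmidt_op lam gam del Xp = real_complex _ (lam j) *: Yp /\
  schmidt_op lam gam del Xm = real_complex _ (lam j) *: Ym.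
Proof.
move=> og od hg hd lamj pos pXp pXm gE Xpm pYp pYm dE Ypm.
have trE i X : \tr (X *m gam i) = hs_dot X (gam i).
  by rewrite /hs_dot; have /hermP -> := hg i.
have opE X : schmidt_op lam gam del X =
    \sum_i (real_complex _ (lam i) * hs_dot X (gam i)) *: del i.
  by apply: eq_bigr => i _; rewrite trE.
(* Orthogonality removes the cross terms, so the absolute values of [gam j] and [del j] still have
   norm 1. *)
have abs1 r (P N : 'M[C]_r) : psdmx P -> psdmx N -> P *m N = 0 ->
    hs_dot (P - N) (P - N) = 1 -> hs_dot (P + N) (P + N) = 1.
  move=> /psd_herm aP /psd_herm aN PN <-.
  have NP : N *m P = 0.
    rewrite -aP -aN -adjmxM PN; apply/matrixP => a b.
    by rewrite !mxE rmorph0.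
  rewrite /hs_dot adjmxB adjmxD aP aN; congr (\tr _).
  rewrite [RHS]mulmxBl !mulmxBr mulmxDl !mulmxDr PN NP.
  by rewrite addr0 subr0 add0r sub0r opprK.
have opj : schmidt_op lam gam del (Xp - Xm) = real_complex _ (lam j) *: (Yp - Ym).
  by rewrite -gE -dE; apply: schmidt_op_basis.
have opabs : schmidt_op lam gam del (Xp + Xm) = real_complex _ (lam j) *: (Yp + Ym).
  rewrite opE; apply: singular_pair_of_max => //.
  - by have /andP[] := lamj j; move=> /le_trans; apply.
  - by apply: abs1; rewrite // -gE og eqxx.
  - by apply: abs1; rewrite // -dE od eqxx.
  rewrite -opE; set L := real_complex _ _.
  have hY : adjmx (Yp + Ym) = Yp + Ym by rewrite adjmxD !psd_herm.
  rewrite /hs_dot hY -schmidt_formE.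
  have LE : L = schmidt_form lam gam del (Xp - Xm) (Yp - Ym).
    rewrite schmidt_formE opj -scalemxAl mxtraceZ -dE.
    have := od j j; rewrite /hs_dot; have /hermP -> := hd j.
    by rewrite eqxx => ->; rewrite mulr1.
  rewrite LE -subr_ge0.
  (* Passing to absolute values only reverses the sign of the mixed terms, which are nonnegative, so
     the form cannot fall below [L]. *)
  have -> : schmidt_form lam gam del (Xp + Xm) (Yp + Ym)
      - schmidt_form lam gam del (Xp - Xm) (Yp - Ym)
      = 2%:R * (schmidt_form lam gam del Xp Ym + schmidt_form lam gam del Xm Yp).
    rewrite /schmidt_form -sumrB -big_split mulr_sumr; apply: eq_bigr => i _ /=.
    by rewrite !mulmxDl !mulNmx !raddfD !raddfN /=; ring.
  by rewrite mulr_ge0 ?ler0n // addr_ge0 // pos.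
have opN X : schmidt_op lam gam del (- X) = - schmidt_op lam gam del X.
  by rewrite -scaleN1r schmidt_opZ scaleN1r.
rewrite schmidt_opD opN in opj; rewrite schmidt_opD in opabs.
have two0 : (2%:R : C) != 0 by rewrite pnatr_eq0.
split; apply: (scalerI two0).
  rewrite !scaler_nat !mulr2n; set L := real_complex _ _ in opj opabs *.
  transitivity (L *: (Yp + Ym) + L *: (Yp - Ym)).
    by rewrite -opj -opabs addrACA subrr addr0.
  by rewrite -scalerDr addrACA subrr addr0 scalerDr.
rewrite !scaler_nat !mulr2n; set L := real_complex _ _ in opj opabs *.
transitivity (L *: (Yp + Ym) - L *: (Yp - Ym)).
  by rewrite -opj -opabs opprB addrC addrA subrK.
by rewrite -scalerBr opprB addrC addrA subrK scalerDr.
Qed.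

End SchmidtOperator.

(** * Supports of positive singular pairs *)
Section Support.
Variable R : realType.
Local Notation C := (R[i]%C).

(* [A] is block diagonal for the splitting along the supports of [X] and [Y]:
   the trace kills the mixed diagonal blocks, and the partial transpose then
   turns the off-diagonal block into a block of a positive matrix in a row
   where it vanishes. *)
Lemma schmidt_support k m n (A : 'M[C]_(k * m)) (lam : 'I_n -> R)
    (gam : 'I_n -> 'M[C]_k) (del : 'I_n -> 'M[C]_m) (L : C)
    (X V Z : 'M[C]_k) (Y W T : 'M[C]_m) :
  weak_irreducible A -> ppt A -> hermitian_schmidt A lam gam del ->
  L != 0 -> psdmx X -> psdmx Y -> Y != 0 ->
  schmidt_op lam gam del X = L *: Y -> schmidt_op lam del gam Y = L *: X ->
  hermitian_projection V -> X *m V = X -> V = X *m Z -> V = Z *m X ->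
  hermitian_projection W -> Y *m W = Y -> W = Y *m T -> W = T *m Y ->
  forall i, gam i *m V = gam i /\ del i *m W = del i.
Proof.
move=> [_ wi] [pA pAt] [lam0 hgd og od AE] L0 pX pY Y0 opX opY pV XV VXZ VZX
  pW YW WYT WTY.
set V' := 1%:M - V; set W' := 1%:M - W.
have pV' : hermitian_projection V' by apply: hermitian_projection_compl.
have pW' : hermitian_projection W' by apply: hermitian_projection_compl.
have [/hermP aV VV] := pV; have [/hermP aW WW] := pW.
have [/hermP aV' VV'] := pV'; have [/hermP aW' WW'] := pW'.
have trA P Q : \tr (A *m (P *t Q)) = \tr (schmidt_op lam gam del P *m Q).
  by rewrite (mxtrace_schmidt _ _ AE) schmidt_formE.
have trA' P Q : \tr (A *m (P *t Q)) = \tr (schmidt_op lam del gam Q *m P).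
  by rewrite (mxtrace_schmidt _ _ AE) schmidt_formC schmidt_formE.
have XV' : X *m V' = 0 by rewrite mulmxBr mulmx1 XV subrr.
have YW' : Y *m W' = 0 by rewrite mulmxBr mulmx1 YW subrr.
have VX : V *m X = X by rewrite -{1}(psd_herm pX) -aV -adjmxM XV psd_herm.
have WY : W *m Y = Y by rewrite -{1}(psd_herm pY) -aW -adjmxM YW psd_herm.
have trb : \tr (A *m (X *t W')) = 0.
  by rewrite trA opX -scalemxAl YW' scaler0 mxtrace0.
have trc : \tr (A *m (V' *t Y)) = 0.
  by rewrite trA' opY -scalemxAl XV' scaler0 mxtrace0.
(* The zero trace gives [A *m (X *t W') = 0]; multiplying by [Z] on the right turns [X] into [V]. *)
have AVW' : A *m (V *t W') = 0.
  rewrite VXZ -[W']mulmx1 -tensmx_mul mulmxA.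
  by rewrite (psd_mxtrace_eq0 pA (psd_tens pX (psd_proj pW')) trb) mul0mx.
have AV'W : A *m (V' *t W) = 0.
  rewrite WYT -[V']mulmx1 -tensmx_mul mulmxA.
  by rewrite (psd_mxtrace_eq0 pA (psd_tens (psd_proj pV') pY) trc) mul0mx.
have adj0 (B D : 'M[C]_(k * m)) : adjmx D = D -> A *m D = 0 -> D *m A = 0.
  move=> aD AD; rewrite -aD -(psd_herm pA) -adjmxM AD.
  by apply/matrixP => a b; rewrite !mxE rmorph0.
have VW'A : (V *t W') *m A = 0 by apply: adj0; rewrite ?adjmx_tens ?aV ?aW'.
have V'WA : (V' *t W) *m A = 0 by apply: adj0; rewrite ?adjmx_tens ?aV' ?aW.
(* Partial transposition exchanges and transposes the outer multipliers of the first factor, and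
   leaves those of the second in place. *)
have pt_congr (P S : 'M[C]_k) (Q U : 'M[C]_m) :
    partial_trmx ((P *t Q) *m A *m (S *t U))
    = (S^T *t Q) *m partial_trmx A *m (P^T *t U).
  have AE' : A = \sum_i (real_complex _ (lam i) *: gam i) *t del i.
    by rewrite AE; apply: eq_bigr => i _; rewrite tensmxZl.
  transitivity (\sum_i (S^T *m (real_complex _ (lam i) *: gam i)^T *m P^T) *t
      (Q *m del i *m U)).
    rewrite [in LHS]AE' mulmx_sumr mulmx_suml.
    rewrite (eq_bigr (fun i => (P *m (real_complex _ (lam i) *: gam i) *m S) *t
      (Q *m del i *m U))); last by move=> i _; rewrite !tensmx_mul.
    rewrite partial_trmx_sum; apply: eq_bigr => i _.
    by rewrite !trmx_mul mulmxA.
  rewrite [in RHS]AE' partial_trmx_sum mulmx_sumr mulmx_suml.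
  by apply: eq_bigr => i _; rewrite !tensmx_mul.
(* Partial transposition only permutes entries. *)
have pt0 (B : 'M[C]_(k * m)) : partial_trmx B = 0 -> B = 0.
  move=> /matrixP h; apply/matrixP => a b.
  case: (mxtens_indexP a) => a1 a2; case: (mxtens_indexP b) => b1 b2.
  have := h (mxtens_index (b1, a2)) (mxtens_index (a1, b2)).
  by rewrite !mxE !mxtens_indexK.
have trbt : \tr (partial_trmx A *m (X^T *t W')) = 0.
  have AtE : partial_trmx A =
      \sum_i real_complex _ (lam i) *: ((gam i)^T *t del i).
    rewrite [in LHS]AE; under eq_bigr do rewrite -tensmxZl.
    rewrite partial_trmx_sum; apply: eq_bigr => i _.
    by rewrite linearZ /= tensmxZl.
  rewrite (mxtrace_schmidt _ _ AtE) -trb (mxtrace_schmidt _ _ AE).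
  apply: eq_bigr => i _; congr (_ * _ * _).
  by rewrite -trmx_mul mxtrace_tr mxtrace_mulC.
have AtVW' : partial_trmx A *m (V^T *t W') = 0.
  rewrite VZX trmx_mul -[W']mulmx1 -tensmx_mul mulmxA.
  by rewrite (psd_mxtrace_eq0 pAt (psd_tens (psd_tr pX) (psd_proj pW')) trbt) mul0mx.
(* Under partial transposition the right multiplier [V' *t W'] becomes [V^T *t W'], which
   [partial_trmx A] annihilates. *)
have off : (V *t W) *m A *m (V' *t W') = 0.
  by apply: pt0; rewrite pt_congr -mulmxA AtVW' mulmx0.
have off' : (V' *t W') *m A *m (V *t W) = 0.
  have := congr1 (@adjmx _ _ _) off.
  rewrite !adjmxM !adjmx_tens aV aW aV' aW' (psd_herm pA) mulmxA => ->.
  by apply/matrixP => a b; rewrite !mxE rmorph0.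
have dec : (1%:M : 'M[C]_(k * m)) = V *t W + V' *t W' + (V *t W' + V' *t W).
  rewrite -tensmx11 -[1%:M in LHS](subrKC V) -[X in _ *t X](subrKC W).
  rewrite -/V' -/W' tensmxDl !tensmxDr.
  by rewrite [V' *t W + _]addrC addrACA.
have AdecR : A = A *m (V *t W + V' *t W').
  rewrite -[LHS]mulmx1 dec [in LHS]mulmxDr [A *m (_ *t W' + _)]mulmxDr.
  by rewrite AVW' AV'W !addr0.
have AdecL : A = (V *t W + V' *t W') *m A.
  rewrite -[LHS]mul1mx dec [in LHS]mulmxDl [(_ *t W' + _) *m A]mulmxDl.
  by rewrite VW'A V'WA !addr0.
have blocks : A = (V *t W) *m A *m (V *t W) + (V' *t W') *m A *m (V' *t W').
  rewrite {1}AdecL {1}AdecR mulmxA [in LHS]mulmxDr !mulmxDl.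
  by rewrite off off' addr0 add0r.
(* For positive [A], a vanishing diagonal block has zero trace, hence its whole block column
   vanishes. *)
have compress P Q : hermitian_projection P -> hermitian_projection Q ->
    (P *t Q) *m A *m (P *t Q) = 0 -> A *m (P *t Q) = 0.
  move=> pP pQ h; apply: (psd_mxtrace_eq0 pA (psd_tens (psd_proj pP) (psd_proj pQ))).
  have [_ PP] := pP; have [_ QQ] := pQ.
  by rewrite -{1}PP -{1}QQ -tensmx_mul mulmxA mxtrace_mulC mulmxA h mxtrace0.
have VV'0 : V *m V' = 0 by rewrite mulmxBr mulmx1 VV subrr.
have WW'0 : W *m W' = 0 by rewrite mulmxBr mulmx1 WW subrr.
have [h|h] := wi V V' W W' pV pV' pW pW' VV'0 WW'0 (subrKC _ _) (subrKC _ _) blocks.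
  (* The block at [V *t W] cannot vanish: otherwise [L * \tr (Y *m Y) = 0], although [L] and [Y] are
     nonzero. *)
  have AXY : \tr (A *m (X *t Y)) = 0.
    by rewrite -VX -WY -tensmx_mul mulmxA compress // mul0mx mxtrace0.
  move: AXY; rewrite trA opX -scalemxAl mxtraceZ => /eqP.
  rewrite mulf_eq0 (negbTE L0) /= => /eqP YY; case/eqP: Y0.
  by apply: hs_dot_eq0; rewrite /hs_dot psd_herm.
have AV'W' := compress _ _ pV' pW' h.
(* The remaining alternative removes the last block meeting [V'] or [W'], so [A] lives on
   [V *t W]. *)
have AV' : A *m (V' *t 1%:M) = 0.
  by rewrite -[1%:M](subrKC W) tensmxDr mulmxDr AV'W AV'W' addr0.
have AW' : A *m (1%:M *t W') = 0.
  by rewrite -[1%:M](subrKC V) tensmxDl mulmxDr AVW' AV'W' addr0.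
have lamn0 j : real_complex _ (lam j) != 0 :> C.
  by rewrite gt_eqF // ltcR lam0.
have basis_g j := schmidt_op_basis lam del j (fun i => (hgd i).1) og.
have basis_d j := schmidt_op_basis lam gam j (fun i => (hgd i).2) od.
have gram0 p (B : 'M[C]_p) : \tr (B *m adjmx B) = 0 -> B = 0 by apply: hs_dot_eq0.
move=> j; split; apply/eqP; rewrite -subr_eq0 -opprB oppr_eq0 -{1}[_ j]mulmx1 -mulmxBr;
  apply/eqP/gram0.
  (* Testing against [del j] isolates the term [j], and the first factor is chosen so that what
     remains is [lam j] times the squared norm of [gam j *m V']. *)
  have : \tr (A *m ((V' *m adjmx (gam j *m V')) *t del j)) = 0.
    by rewrite -[del j]mul1mx -tensmx_mul mulmxA AV' mul0mx mxtrace0.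
  rewrite trA' basis_d -scalemxAl mxtraceZ mulmxA => /eqP.
  by rewrite mulf_eq0 (negbTE (lamn0 _)) => /eqP.
have : \tr (A *m (gam j *t (W' *m adjmx (del j *m W')))) = 0.
  by rewrite -[gam j]mul1mx -tensmx_mul mulmxA AW' mul0mx mxtrace0.
rewrite trA basis_g -scalemxAl mxtraceZ mulmxA => /eqP.
by rewrite mulf_eq0 (negbTE (lamn0 _)) => /eqP.
Qed.

End Support.

(** * Separability from a common support *)

Section SeparabilityCriterion.
Variable R : realType.
Local Notation C := (R[i]%C).

(** The Kronecker product of the two eigenvectors is an eigenvector. This makes the product of the
    least eigenvalues on the supports comparable with [mu]. *)
Lemma eigenvalue_tens k m (X : 'M[C]_k) (Y : 'M[C]_m) a b :
  eigenvalue X a -> eigenvalue Y b -> eigenvalue (X *t Y) (a * b).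
Proof.
move=> /eigenvalueP [u uX u0] /eigenvalueP [v vY v0].
apply/eigenvalueP; exists (u *t v : 'rV_(k * m)).
  by rewrite (tensmx_mul u v) uX vY tensmxZl tensmxZr scalerA.
have [i ui] : exists i, u 0 i != 0 by apply/rV0Pn.
have [j vj] : exists j, v 0 j != 0 by apply/rV0Pn.
apply/rV0Pn; exists (mxtens_index (i, j)).
by rewrite mxE mxtens_indexK /= [X in u X]ord1 [X in v X]ord1 mulf_neq0.
Qed.

(** The telescoping [X *t Y - (a * b) *: (V *t W) = (X - a *: V) *t Y + a *: (V *t (Y - b *: W))]
    frees [lam j * (a * b)] copies of [V *t W]. One copy per unit of [lam i] is spent on each other
    term, and the numerical hypothesis leaves a nonnegative surplus. *)
Lemma separable_of_support k m n (lam : 'I_n -> R) (gam : 'I_n -> 'M[C]_k)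
    (del : 'I_n -> 'M[C]_m) (A : 'M[C]_(k * m)) j
    (X V : 'M[C]_k) (Y W : 'M[C]_m) (a b : C) :
  hermitian_schmidt A lam gam del ->
  gam j *t del j = X *t Y -> psdmx Y ->
  hermitian_projection V -> hermitian_projection W ->
  0 <= a -> psdmx (X - a *: V) -> psdmx (Y - b *: W) ->
  (forall i, gam i *m V = gam i /\ del i *m W = del i) ->
  real_complex _ (\sum_(i | i != j) lam i) <= real_complex _ (lam j) * (a * b) ->
  separable A.
Proof.
move=> [lam0 hgd og od AE] gdE pY pV pW a0 pXV pYW sup lamab.
have lam0' i : 0 <= real_complex _ (lam i) by rewrite ler0c ltW.
have -> : A = real_complex _ (lam j) *: ((X - a *: V) *t Y + a *: (V *t (Y - b *: W)))
   + (real_complex _ (lam j) * (a * b) - real_complex _ (\sum_(i | i != j) lam i))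
       *: (V *t W)
   + \sum_(i | i != j) real_complex _ (lam i) *: (V *t W + gam i *t del i).
  rewrite AE (bigD1 j) //= gdE.
  have -> : \sum_(i | i != j) real_complex _ (lam i) *: (V *t W + gam i *t del i) =
      real_complex _ (\sum_(i | i != j) lam i) *: (V *t W)
      + \sum_(i | i != j) real_complex _ (lam i) *: (gam i *t del i).
    rewrite rmorph_sum scaler_suml -big_split.
    by apply: eq_bigr => i _; rewrite scalerDr.
  rewrite addrA; congr (_ + _).
  rewrite scalerBl addrA subrK -scalerA -scalerDr; congr (_ *: _).
  rewrite tensmxDl tensmxNl tensmxZl tensmxDr tensmxNr tensmxZr.
  by rewrite scalerDr scalerN scalerA addrA !subrK.
apply: separableD; [apply: separableD|].
- apply: separableZ => //; apply: separableD; first exact: separable_tens.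
  by apply: separableZ => //; apply: separable_tens => //; apply: psd_proj.
- apply: separableZ; first by rewrite subr_ge0.
  by apply: separable_tens; apply: psd_proj.
apply: separable_sum => i _; apply: separableZ => //.
have [[hg hd] [gV dW]] := (hgd i, sup i).
by apply: separable_proj_shift; rewrite ?og ?od ?eqxx.
Qed.

End SeparabilityCriterion.

Theorem theorem5p3 (R : realType) (k m n : nat) (A : 'M[R[i]%C]_(k * m))
    (lam : 'I_n -> R) (gam : 'I_n -> 'M[R[i]%C]_k) (del : 'I_n -> 'M[R[i]%C]_m)
    (mu : R) (n_ge2 : (2 <= n)%N) (i1 : 'I_n) (i1_first : i1 = 0%N :> nat) :
  weak_irreducible A ->
  ppt A ->
  hermitian_schmidt A lam gam del ->
  (forall i j : 'I_n, (i <= j)%N -> lam j <= lam i) ->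
  least_positive_eigenvalue (gam i1 *t del i1) mu ->
  1 <= lam i1 * mu / (\sum_(i < n | (0 < i)%N) lam i) ->
  separable A.
Proof.
move=> wiA pptA schA mono [mu0 _ mumin] ineq.
have [lam0 hgd og od AE] := schA.
have S_le : \sum_(i | i != i1) lam i <= lam i1 * mu.
  have SE : \sum_(i < n | (0 < i)%N) lam i = \sum_(i | i != i1) lam i.
    by apply: eq_bigl => i; rewrite -val_eqE /= i1_first lt0n.
  move: ineq; rewrite SE; set S := \sum_(i | _) _ => ineq.
  have S0 : 0 <= S by apply: sumr_ge0 => i _; rewrite ltW.
  (* A zero sum is excluded: division by 0 gives 0, so the hypothesis would read [1 <= 0]. *)
  move: S0; rewrite le0r => /orP[/eqP S0|S0].
    by move: ineq; rewrite S0 invr0 mulr0 ler10.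
  by move: ineq; rewrite ler_pdivlMr // mul1r.
have hg i := (hgd i).1; have hd i := (hgd i).2.
have lamj i : 0 <= lam i <= lam i1.
  by rewrite ltW //= mono // i1_first.
have pos X Y : psdmx X -> psdmx Y -> 0 <= schmidt_form lam gam del X Y.
  move=> pX pY; rewrite -(mxtrace_schmidt _ _ AE); apply: psd_mxtrace_ge0.
    by case: pptA.
  exact: psd_tens.
have pos' Y X : psdmx Y -> psdmx X -> 0 <= schmidt_form lam del gam Y X.
  by move=> pY pX; rewrite schmidt_formC; apply: pos.
have [Xp [Xm [pXp pXm gE Xpm]]] := jordan_decomposition (hg i1).
have [Yp [Ym [pYp pYm dE Ypm]]] := jordan_decomposition (hd i1).
have [opXp opXm] := top_positive_part og od hg hd lamj pos pXp pXm gE Xpm pYp pYm dE Ypm.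
have [opYp opYm] := top_positive_part od og hd hg lamj pos' pYp pYm dE Ypm pXp pXm gE Xpm.
have L0 : real_complex _ (lam i1) != 0 by rewrite gt_eqF // ltcR.
have op0 p q (g : 'I_n -> 'M[R[i]%C]_p) (d : 'I_n -> 'M[R[i]%C]_q) :
    schmidt_op lam g d 0 = 0.
  by rewrite -(scale0r 0) schmidt_opZ scale0r.
have eq0_of_op p q (g : 'I_n -> 'M[R[i]%C]_p) (d : 'I_n -> 'M[R[i]%C]_q) P Q :
    schmidt_op lam g d P = real_complex _ (lam i1) *: Q -> P = 0 -> Q = 0.
  by move=> + P0; rewrite P0 op0 => /esym/eqP; rewrite scaler_eq0 (negbTE L0) => /eqP.
have mulC0 p (P Q : 'M[R[i]%C]_p) : psdmx P -> psdmx Q -> P *m Q = 0 -> Q *m P = 0.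
  move=> /psd_herm aP /psd_herm aQ PQ; rewrite -aP -aQ -adjmxM PQ.
  by apply/matrixP => r s; rewrite !mxE rmorph0.
(* [X], [Y] are the positive or the negative parts, with [X', Y'] the others. *)
have core X X' Y Y' : X != 0 -> psdmx X -> psdmx Y ->
    X' *m X = 0 -> Y' *m Y = 0 ->
    schmidt_op lam gam del X = real_complex _ (lam i1) *: Y ->
    schmidt_op lam del gam Y = real_complex _ (lam i1) *: X ->
    (gam i1 = X - X' /\ del i1 = Y - Y') \/ (gam i1 = X' - X /\ del i1 = Y' - Y) ->
    separable A.
  move=> X0 pX pY X'X Y'Y opX opY gd.
  have Y0 : Y != 0.
    by apply: contra X0 => /eqP Y0; apply/eqP/(eq0_of_op _ _ _ _ _ _ opY).
  have [V [Z [a [pV XV VXZ VZX [a0 eva pXV]]]]] := psd_support pX X0.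
  have [W [T [b [pW YW WYT WTY [b0 evb pYW]]]]] := psd_support pY Y0.
  have sup := schmidt_support wiA pptA schA L0 pX pY Y0 opX opY
    pV XV VXZ VZX pW YW WYT WTY.
  (* The opposite parts vanish on the supports, whereas every [gam i] and [del i] is carried by
     them, so the opposite parts drop out of [gam i1] and [del i1]. If the negative parts survive,
     the two signs cancel in the tensor product. *)
  have X'V : X' *m V = 0 by rewrite VXZ mulmxA X'X mul0mx.
  have Y'W : Y' *m W = 0 by rewrite WYT mulmxA Y'Y mul0mx.
  have gdE : gam i1 *t del i1 = X *t Y.
    have [gV dW] := sup i1; rewrite -gV -dW.
    case: gd => [[-> ->]|[-> ->]]; rewrite !mulmxBl X'V Y'W XV YW.
      by rewrite !subr0.
    by rewrite !sub0r tensmxNl tensmxNr opprK.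
  have ab0 : 0 < a * b by rewrite mulr_gt0.
  (* [a] and [b] are complex scalars; their positive product is real, and as an eigenvalue of
     [gam i1 *t del i1] it is at least [mu]. *)
  have [nu abE] : exists nu, a * b = real_complex _ nu.
    by apply/complex_realP; rewrite realE ltW.
  apply: (separable_of_support schA gdE pY pV pW (ltW a0) pXV pYW sup).
  rewrite abE -rmorphM lecR (le_trans S_le) //= ler_pM2l //.
  apply: mumin; first by rewrite -ltcR -abE.
  by rewrite gdE -abE; apply: eigenvalue_tens.
(* Since [gam i1] has norm 1, one of its two parts is nonzero, and [core] is applied to that one. *)
have [Xp0|Xp0] := eqVneq Xp 0; last first.
  by apply: (core Xp Xm Yp Ym) => //; [exact: mulC0|exact: mulC0|left].
have Xm0 : Xm != 0.
  apply/eqP => Xm0; have := og i1 i1.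
  rewrite gE Xp0 Xm0 subrr eqxx /hs_dot mul0mx mxtrace0 => /eqP.
  by rewrite eq_sym oner_eq0.
by apply: (core Xm Xp Ym Yp) => //; right.
Qed.
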